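(* For any multi-indices $\mathbf{k}$ and $\mathbf{b}$, one has $$\mathcal{C}_{\mathbf{k},\mathbf{b}}(u)=\sum_{\mathbf{n}\in\mathcal{N}(\mathbf{k},\mathbf{b})}\left(\prod_{a\in A}\prod_{j\ge -1}\frac{k_j^a!}{\prod_{s=-1}^{j}n_{a,j,s}!}\right)\frac{u^{\sum_{a\in A}\sum_{j\ge -1}\sum_{s=-1}^{j}(j-s)n_{a,j,s}}}{\prod_{a\in A}\prod_{j\ge -1}\prod_{s=-1}^{j}\big((j-s)!\big)^{n_{a,j,s}}}.$$ In particular, $\mathcal{C}_{\mathbf{k},\mathbf{b}}(u)=0$ if $\mathcal{N}(\mathbf{k},\mathbf{b})=\emptyset$.
   Context: $A$ is a finite set, $\mathbb{K}$ is a field of characteristic zero, and $I_A:=A\times\mathbb{Z}_{\ge -1}$. A multi-index is a finitely supported map $\mathbf{k}:I_A\to\mathbb{Z}_{\ge 0}$, written $k_j^a:=\mathbf{k}(a,j)$. $N(A)$ is the polynomial algebra over $\mathbb{K}$ in the variables $x_j^a$ ($a\in A$, $j\ge -1$), and $\mathbf{x}^{\mathbf{k}}:=\prod_{a,j}(x_j^a)^{k_j^a}$. $\bar\partial:N(A)\to N(A)$ is the derivation with $\bar\partial(x_j^a)=x_{j-1}^a$ for $j\ge 0$ and $\bar\partial(x_{-1}^a)=0$. It is locally nilpotent, and one defines the polynomial in $u$ with coefficients in $N(A)$ $$\mathcal{C}_{\mathbf{k}}(u;\mathbf{x}):=\sum_{r\ge 0}\frac{u^r}{r!}\bar\partial^{\,r}\mathbf{x}^{\mathbf{k}},\qquad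 \mathcal{C}_{\mathbf{k},\mathbf{b}}(u):=[\mathbf{x}^{\mathbf{b}}]\,\mathcal{C}_{\mathbf{k}}(u;\mathbf{x}),$$ the latter being the coefficient of the monomial $\mathbf{x}^{\mathbf{b}}$ (a polynomial in $u$ over $\mathbb{K}$). A transport array from $\mathbf{k}$ to $\mathbf{b}$ is a family $\mathbf{n}=(n_{a,j,s})_{a\in A,\,-1\le s\le j}$ of nonnegative integers such that $\sum_{s=-1}^{j}n_{a,j,s}=k_j^a$ for every $a\in A$, $j\ge -1$, and $\sum_{j\ge s}n_{a,j,s}=b_s^a$ for every $a\in A$, $s\ge -1$. $\mathcal{N}(\mathbf{k},\mathbf{b})$ is the set of all transport arrays from $\mathbf{k}$ to $\mathbf{b}$. *)

(* Defs.v *)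
From HB Require Import structures.
From mathcomp Require Import all_boot all_order all_algebra finmap.
From mathcomp Require Import boolp classical_sets functions cardinality fsbigop.
From mathcomp Require Import monalg zify.
Set Implicit Arguments.
Unset Strict Implicit.
Unset Printing Implicit Defensive.
Import Order.TTheory GRing.Theory Num.Theory.
Local Open Scope classical_set_scope.
Local Open Scope ring_scope.

(* A [{cmonom I}] is a finitely supported map I -> nat; [{malg K[{cmonom I}]}]
   is the polynomial algebra over K in variables indexed by I. *)
Section Polynomials.
Variables (K : fieldType) (I : choiceType).
Implicit Types (m k : {cmonom I}) (p q : {malg K[{cmonom I}]}).

Definition xvar (i : I) : {malg K[{cmonom I}]} := << ucm i >>.

Definition xmon k : {malg K[{cmonom I}]} := \prod_(i <- finsupp k) xvar i ^+ k i.

(* [mder f] is the K-derivation with x_i |-> f i, computed on a monomial x^m as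
   the sum over i of (d x^m / d x_i) * f i; see [mder_is_linear], [mderM] and
   [mder_xvar] below. *)
Definition mder_mon (f : I -> {malg K[{cmonom I}]}) m : {malg K[{cmonom I}]} :=
  \sum_(i <- finsupp m) (f i * << divcm m (ucm i) >>) *+ m i.

Definition mder (f : I -> {malg K[{cmonom I}]}) p : {malg K[{cmonom I}]} :=
  \sum_(m <- msupp p) p@_m *: mder_mon f m.

Lemma monM m1 m2 :
  << m1 >> * << m2 >> = << mmul m1 m2 >> :> {malg K[{cmonom I}]}.
Proof. by rewrite malgM_def fgmulUU mulr1. Qed.

Lemma xmonE k : xmon k = << k >>.
Proof.
have xX (i : I) n : xvar i ^+ n = << iter n (mmul (ucm i)) mone >>.
  elim: n => [|n IH]; first by rewrite expr0.
  by rewrite exprS {}IH /xvar monM iterS.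
have iterE (i j : I) n :
    (iter n (mmul (ucm i)) mone : {cmonom I}) j = ((i == j) * n)%N.
  elim: n => [|n IH]; first by rewrite muln0 cm1.
  by rewrite iterS cmM {}IH cmU mulnS.
have -> : xmon k = << \big[mmul/mone]_(i <- finsupp k)
    (iter (k i) (mmul (ucm i)) mone : {cmonom I}) >>.
  rewrite /xmon; elim: (enum_fset (finsupp k)) => [|i s IH].
    by rewrite !big_nil.
  by rewrite !big_cons {}IH xX monM.
congr << _ >>; apply/eqP/cmP => j.
have -> (s : seq I) (F : I -> {cmonom I}) :
    (\big[mmul/mone]_(i <- s) F i) j = (\sum_(i <- s) F i j)%N.
  elim: s => [|i s IH]; first by rewrite !big_nil cm1.
  by rewrite !big_cons cmM {}IH.
under eq_bigr do rewrite iterE.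
case: (mdomP k j) => [jk|/negP jk].
  rewrite (big_fsetD1 j) //= eqxx mul1n big1_fset ?addn0 // => i.
  by rewrite in_fsetD1 => /andP[/negPf -> _].
by rewrite big_seq big1 // => i ik; case: eqP ik jk => // -> ->.
Qed.

Section Derivation.
Variable f : I -> {malg K[{cmonom I}]}.

Lemma mder_monEw m (d : {fset I}) : (finsupp m `<=` d)%fset ->
  mder_mon f m = \sum_(i <- d) (f i * << divcm m (ucm i) >>) *+ m i.
Proof.
move=> le; rewrite /mder_mon (big_fset_incl _ le) // => i _.
by rewrite memNfinsupp => /eqP ->.
Qed.

Lemma mderEw p (d : {fset {cmonom I}}) : (msupp p `<=` d)%fset ->
  mder f p = \sum_(m <- d) p@_m *: mder_mon f m.
Proof.
move=> le; rewrite /mder (big_fset_incl _ le) // => i _ /mcoeff_outdom ->.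
by rewrite scale0r.
Qed.

Lemma mder_is_linear : linear (mder f).
Proof.
move=> c p q; pose d := (msupp p `|` msupp q `|` msupp (c *: p + q))%fset.
have lp : (msupp p `<=` d)%fset by rewrite /d -fsetUA fsubsetUl.
have lq : (msupp q `<=` d)%fset.
  by rewrite /d [X in (X `|` _)%fset]fsetUC -fsetUA fsubsetUl.
have lr : (msupp (c *: p + q) `<=` d)%fset by rewrite fsubsetUr.
rewrite (mderEw lp) (mderEw lq) (mderEw lr) scaler_sumr -big_split /=.
by apply: eq_bigr => m _; rewrite mcoeffD mcoeffZ scalerDl scalerA.
Qed.

HB.instance Definition _ :=
  GRing.isLinear.Build K {malg K[{cmonom I}]} {malg K[{cmonom I}]} *:%R
    (mder f) mder_is_linear.

Lemma mderU m : mder f << m >> = mder_mon f m.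
Proof. by rewrite /mder msuppU1 big_seq_fset1 mcoeffUU scale1r. Qed.

Lemma mder_xvar i : mder f (xvar i) = f i.
Proof.
rewrite mderU /mder_mon mdomU big_seq_fset1 cmUU mulr1n.
have -> : divcm (ucm i) (ucm i) = mone.
  by apply/eqP/cmP => j; rewrite divcmE subnn cm1.
by rewrite mulr1.
Qed.

Lemma mder_monM m1 m2 :
  mder_mon f (mmul m1 m2) = mder_mon f m1 * << m2 >> + << m1 >> * mder_mon f m2.
Proof.
pose d := (finsupp m1 `|` finsupp m2)%fset.
rewrite (@mder_monEw m1 d) ?fsubsetUl // (@mder_monEw m2 d) ?fsubsetUr //.
rewrite (@mder_monEw _ d) ?mdomD //.
rewrite mulr_suml mulr_sumr -big_split /=; apply: eq_bigr => i _.
have step n m : (f i * << divcm n (ucm i) >>) *+ n i * << m >>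
    = (f i * << divcm (mmul n m) (ucm i) >>) *+ n i.
  rewrite mulrnAl; have [z|ni] := eqVneq (n i) 0%N.
    by rewrite z [LHS]mulr0n [RHS]mulr0n.
  have E : mmul (divcm n (ucm i)) m = divcm (mmul n m) (ucm i).
    apply/eqP/cmP => j.
    rewrite cmM !divcmE cmM cmU; case: eqP => [<-|_]; last by rewrite !subn0.
    by rewrite addnBAC // lt0n.
  by rewrite -mulrA monM E.
have gen (R : comNzRingType) (x y z u v : R) n1 n2 : x *+ n1 * u = z *+ n1 ->
    y *+ n2 * v = z *+ n2 -> z *+ (n1 + n2) = x *+ n1 * u + v * (y *+ n2).
  by move=> e1 e2; rewrite mulrnDr -e1 -e2 [v * _]mulrC.
rewrite cmM; apply: gen; first exact: step.
by move: (step m2 m1); rewrite mulmC.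
Qed.

Lemma mderM p q : mder f (p * q) = mder f p * q + p * mder f q.
Proof.
have monZ (r : {malg K[{cmonom I}]}) : r = \sum_(m <- msupp r) r@_m *: << m >>.
  rewrite {1}[r]monalgE; apply: eq_bigr => m _; apply/malgP => n.
  by rewrite mcoeffZ [LHS]mcoeffU [X in _ * X]mcoeffU mulrnAr mulr1.
have gen (L : algType K) (D : {linear L -> L}) (T : Type) (u : T -> L)
    (r s : seq T) (c e : T -> K) :
    (forall i j, D (u i * u j) = D (u i) * u j + u i * D (u j)) ->
    let x := \sum_(i <- r) c i *: u i in let y := \sum_(i <- s) e i *: u i in
    D (x * y) = D x * y + x * D y.
  move=> DM /=; rewrite mulr_suml !raddf_sum /= !mulr_suml -big_split /=.
  apply: eq_bigr => i _; rewrite !mulr_sumr !raddf_sum /= -big_split /=.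
  apply: eq_bigr => j _.
  by rewrite -scalerAl -scalerAr !linearZ /= -!scalerAl -!scalerAr DM !scalerDr.
rewrite [p]monZ [q]monZ; apply: (gen _ (mder f)) => m1 m2 /=.
rewrite [X in mder _ X]monM [LHS]mderU [X in X * _]mderU [X in _ + _ * X]mderU.
exact: mder_monM.
Qed.

End Derivation.

(* If f strictly lowers a weight w on the variables, [mder f] is locally
   nilpotent. *)
Section Nilpotency.
Variables (f : I -> {malg K[{cmonom I}]}) (w : I -> nat).

Let wt m := (\sum_(i <- finsupp m) m i * w i)%N.

Let wtEw m (d : {fset I}) : (finsupp m `<=` d)%fset ->
  wt m = (\sum_(i <- d) m i * w i)%N.
Proof.
move=> le; rewrite /wt (big_fset_incl _ le) // => i _.
by rewrite memNfinsupp => /eqP ->.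
Qed.

Let wtM m1 m2 : wt (mmul m1 m2) = (wt m1 + wt m2)%N.
Proof.
rewrite {1}/wt mdomD (wtEw (fsubsetUl _ (finsupp m2))).
rewrite (wtEw (fsubsetUr (finsupp m1) _)) -big_split /=.
by apply: eq_bigr => i _; rewrite cmM mulnDl.
Qed.

Let wtU i : wt (ucm i) = w i.
Proof. by rewrite /wt mdomU big_seq_fset1 cmUU mul1n. Qed.

Hypothesis f_low : forall i,
  f i = 0 \/ exists2 j, (w j < w i)%N & f i = xvar j.

Let low n p := forall m, (n <= wt m)%N -> p@_m = 0.

Let low_sum n (J : eqType) (r : seq J) (F : J -> {malg K[{cmonom I}]}) :
  (forall i, i \in r -> low n (F i)) -> low n (\sum_(i <- r) F i).
Proof.
by move=> lF m le; rewrite raddf_sum big_seq big1 // => i Pi; apply: lF.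
Qed.

Let low_mder n p : low n.+1 p -> low n (mder f p).
Proof.
move=> lp; apply: low_sum => m.
rewrite -mcoeff_neq0 => pm; have {pm lp} wm : (wt m <= n)%N.
  by rewrite leqNgt; apply: contra pm => /lp ->.
move=> m' le; rewrite mcoeffZ; suff -> : (mder_mon f m)@_m' = 0 by rewrite mulr0.
move: m' le; apply: low_sum => i im m' le; rewrite mcoeffMn.
suff -> : (f i * << divcm m (ucm i) >>)@_m' = 0 by rewrite mul0rn.
case: (f_low i) => [->|[j lt_ji ->]]; first by rewrite mul0r mcoeff0.
rewrite /xvar monM mcoeffU1; case: eqP => // E.
have mE : m = mmul (ucm i) (divcm m (ucm i)).
  apply/eqP/cmP => l; rewrite cmM divcmE cmU subnKC //.
  by case: eqP => // <-; rewrite lt0n cmE_neq0.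
have: (wt m < wt m)%N; last by rewrite ltnn.
apply: leq_ltn_trans (leq_trans wm le) _.
by rewrite -E [in X in (_ < X)%N]mE !wtM !wtU ltn_add2r.
Qed.

Lemma mder_nilpotent p : exists n, forall r, (n <= r)%N -> iter r (mder f) p = 0.
Proof.
exists (\max_(m <- msupp p) (wt m).+1)%N => r le_nr; apply/malgP => m.
suff lr : low (\max_(m <- msupp p) (wt m).+1 - r) (iter r (mder f) p).
  by rewrite mcoeff0; apply: lr; rewrite (eqP le_nr).
elim: r {le_nr} => [|r IH]; last first.
  rewrite iterS; apply: low_mder => l le; apply: IH; apply: leq_trans le.
  by rewrite subnS leqSpred.
rewrite subn0 => l; apply: contraTeq; rewrite mcoeff_neq0 -ltnNge => pl.
by rewrite (big_fsetD1 l) //= leq_max leqnn.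
Qed.

End Nilpotency.
End Polynomials.

Definition zidx := {j : int | -1 <= j}.
HB.instance Definition _ := SubChoice.copy zidx {j : int | -1 <= j}.

(* the index set I_A = A x Z_{>= -1} *)
Definition varidx (A : finType) : choiceType := (A * zidx)%type.
Notation multiindex A := {cmonom (varidx A)}.
Notation NA K A := {malg K[{cmonom (varidx A)}]}.

Section GeneratingPolynomial.
Variables (K : fieldType) (A : finType).
Implicit Types (k b : multiindex A) (p : NA K A).

(* x_{j-1}^a, with the convention x_{-2}^a = 0: [insub] fails on -2. *)
Definition xpred (i : varidx A) : NA K A :=
  if insub (val i.2 - 1) is Some j then xvar K ((i.1, j) : varidx A) else 0.

Definition dbar : NA K A -> NA K A := mder xpred.

Lemma dbar_nilpotent p : exists n, forall r, (n <= r)%N -> iter r dbar p = 0.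
Proof.
pose w (i : varidx A) := absz (val i.2 + 1).
suff low i : xpred i = 0 \/ exists2 j, (w j < w i)%N & xpred i = xvar K j.
  exact: (mder_nilpotent low).
case: i => a j; rewrite /xpred /=; case: insubP => [l _ El|_]; last by left.
right; exists (a, l) => //; rewrite /w /= El subrK.
have := valP l; rewrite El; case: j {El} => /= -[n|[|n]] //= _; lia.
Qed.

(* The sum over r >= 0 has finite support by [dbar_nilpotent]. *)
Definition Cgen k : {poly NA K A} :=
  \sum_(r \in [set: nat])
    ((r`!%:R^-1 : K) *: iter r dbar (xmon K k)) *: 'X^r.

Definition Cgen_coef k b : {poly K} := map_poly (mcoeff b) (Cgen k).

Lemma dbar_xvar0 a (j : zidx) : val j = -1 -> dbar (xvar K ((a, j) : varidx A)) = 0.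
Proof.
move=> j1; rewrite /dbar mder_xvar /xpred /= j1; by case: insubP.
Qed.

Lemma dbar_xvarS a (j l : zidx) : val j = val l + 1 ->
  dbar (xvar K ((a, j) : varidx A)) = xvar K ((a, l) : varidx A).
Proof.
move=> jl; rewrite /dbar mder_xvar /xpred /= jl addrK.
case: insubP => [l' _ /val_inj -> //|/negP[]]; exact: (valP l).
Qed.

Lemma dbarM p q : dbar (p * q) = dbar p * q + p * dbar q.
Proof. exact: mderM. Qed.

End GeneratingPolynomial.

(* A family (n_{a,j,s})_{s <= j} is encoded as a total function that vanishes
   when j < s, so that distinct elements of [transport k b] are distinct
   families. *)
Definition transport (A : finType) (k b : multiindex A) :
    set (A -> zidx -> zidx -> nat) :=
  [set n | [/\ forall a j s, val j < val s -> n a j s = 0%N,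
     forall a j, \big[addn/0%N]_(s \in [set s | val s <= val j]) n a j s
                 = k (a, j)
   & forall a s, \big[addn/0%N]_(j \in [set j | val s <= val j]) n a j s
                 = b (a, s)]].

Lemma finite_zidx_le (j : zidx) : finite_set [set s : zidx | val s <= val j].
Proof.
pose g (n : nat) : zidx := insubd j (n%:Z - 1).
apply: (sub_finite_set _ (finite_image g (finite_II (absz (val j + 1)).+1))).
move=> s /= sj; exists (absz (val s + 1)).
  have h1 := valP s; have h2 := valP j; rewrite /= in h1 h2.
  by rewrite /=; lia.
apply: val_inj; rewrite val_insubd; have h := valP s; rewrite /= in h.
by case: ifP => /=; lia.
Qed.

Lemma transport_le (A : finType) (k b : multiindex A) n : transport k b n ->
  forall a j s, (n a j s <= k (a, j))%N.
Proof.
move=> [n0 nk _] a j s; have [js|sj] := ltP (val j) (val s); first by rewrite n0.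
rewrite -nk fsbig_finite; last exact: finite_zidx_le.
rewrite (big_fsetD1 s) /= ?leq_addr // in_fset_set; last exact: finite_zidx_le.
by rewrite inE.
Qed.

(* Hence all the sums and products over j below, and the one in the second
   marginal condition, have finite support, contained in that of k. *)
Lemma transport_finite (A : finType) (k b : multiindex A) :
  finite_set (transport k b).
Proof.
pose D : set (A * zidx * zidx) :=
  \bigcup_(i in [set` finsupp k])
    [set (i, s) | s in [set s : zidx | val s <= val i.2]].
have fD : finite_set D.
  apply: bigcup_finite => [|i _]; first exact: finite_fset.
  by apply: finite_image; exact: finite_zidx_le.
pose E := fset_set D; pose B := (\sum_(i <- finsupp k) k i)%N.
pose F (g : {ffun E -> 'I_B.+1}) (a : A) (j s : zidx) : nat :=
  if insub ((a, j, s) : A * zidx * zidx) is Some t then g t else 0%N.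
apply: (sub_finite_set (B := range F)); last first.
  by apply: finite_image; exact: finite_finset.
move=> n nt; have le := transport_le nt; have [n0 _ _] := nt.
exists [ffun t : E => inord (n (val t).1.1 (val t).1.2 (val t).2)] => //.
apply/funext => a; apply/funext => j; apply/funext => s; rewrite /F.
case: insubP => [t _ tE|].
  rewrite ffunE tE /= inordK // ltnS (leq_trans (le a j s)) //.
  rewrite /B; case: (mdomP k (a, j)) => // kaj.
  by rewrite (big_fsetD1 (a, j)) //= leq_addr.
rewrite in_fset_set // => /negP h; apply/esym/eqP.
have [js|sj] := ltP (val j) (val s); first by rewrite n0.
apply: contra_notT h => nn; rewrite inE; exists (a, j) => /=; last by exists s.
rewrite -cmE_neq0; apply: contra nn => /eqP k0.
by rewrite -leqn0 -k0.
Qed.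

Definition zgap (j s : zidx) : nat := absz (val j - val s).

Definition transport_coef (K : fieldType) (A : finType) (k : multiindex A)
    (n : A -> zidx -> zidx -> nat) : K :=
  \prod_(a : A) \big[*%R/1]_(j \in [set: zidx])
     ((k (a, j))`!%:R
      / \big[*%R/1]_(s \in [set s : zidx | val s <= val j])
          ((n a j s)`!%:R : K)).

Definition transport_weight (A : finType) (n : A -> zidx -> zidx -> nat) : nat :=
  (\sum_(a : A) \big[addn/0]_(j \in [set: zidx])
     \big[addn/0]_(s \in [set s : zidx | (val s <= val j)%R])
       (zgap j s * n a j s))%N.

Definition transport_denom (K : fieldType) (A : finType)
    (n : A -> zidx -> zidx -> nat) : K :=
  \prod_(a : A) \big[*%R/1]_(j \in [set: zidx])
     \big[*%R/1]_(s \in [set s : zidx | val s <= val j])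
       ((zgap j s)`!%:R ^+ n a j s : K).

(* Main.v *)
(* Since dbar is a derivation, u |-> sum_r u^r dbar^r / r! is multiplicative, and
   it sends x_j^a to sum_(s <= j) u^(j-s) / (j-s)! x_s^a. Peeling one variable off
   x^k therefore gives
     C_{k + e_(a,j), b} = sum_(s <= j) u^(j-s) / (j-s)! C_{k, b - e_(a,s)}.
   The sum over transport arrays obeys the same recursion: write k_j^a as
   sum_s n_{a,j,s}, i.e. mark one unit of the row (a, j), and remove the marked
   unit from the array. Induction on |k| concludes. *)
From HB Require Import structures.
Require Import Defs.
From mathcomp Require Import all_boot all_order all_algebra finmap.
From mathcomp Require Import boolp classical_sets functions cardinality fsbigop.
From mathcomp Require Import monalg zify.
Import Order.TTheory GRing.Theory Num.Theory.
Local Open Scope classical_set_scope.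
Local Open Scope ring_scope.

(** * Iterated Leibniz rule and its divided-power form *)

Section Leibniz.
Variables (K : fieldType) (L : algType K) (D : {linear L -> L}).
Hypothesis DM : forall p q, D (p * q) = D p * q + p * D q.

Lemma iter_derivM p q r :
  iter r D (p * q) =
  \sum_(i < r.+1) (iter i D p * iter (r - i) D q) *+ 'C(r, i).
Proof.
elim: r => [|r IH]; first by rewrite big_ord1.
rewrite iterS IH raddf_sum /=.
under eq_bigr => i _ do rewrite raddfMn /= DM -!iterS -subSn -1?ltnS // mulrnDl.
rewrite big_split /= [in RHS]big_ord_recl [in RHS]/= bin0.
rewrite [X in _ + X]big_ord_recl /= bin0 addrCA; congr (_ + _).
(* Pascal's rule splits the right-hand sum into two matching those obtained by applying [D]; the
   surplus last term carries ['C(r, r.+1) = 0]. *)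
under [in RHS]eq_bigr => i _ do rewrite /= /bump /= add1n binS mulrnDr subSS.
rewrite big_split /= addrC; congr (_ + _); rewrite [in RHS]big_ord_recr /=.
by rewrite bin_small // mulr0n addr0.
Qed.

Hypothesis charK : [pchar K] =i pred0.

(** Since ['C(r, i) / r! = 1 / (i! (r - i)!)] in characteristic zero, Leibniz becomes a Cauchy
    product. This is the multiplicativity of $\sum_r u^r D^r / r!$, read off at $u^r$. *)
Lemma iter_derivM_div p q r :
  r`!%:R^-1 *: iter r D (p * q) =
  \sum_(i < r.+1)
    (i`!%:R^-1 *: iter i D p) * ((r - i)`!%:R^-1 *: iter (r - i) D q).
Proof.
rewrite iter_derivM scaler_sumr; apply: eq_bigr => i _.
rewrite -scalerAl -scalerAr scalerA -scaler_nat scalerA; congr (_ *: _).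
have ir : (i <= r)%N by rewrite -ltnS.
rewrite -(bin_fact ir) !natrM !invfM [X in X * _]mulrC.
have Cn0 : 'C(r, i)%:R != 0 :> K by rewrite ((pcharf0P K).1 charK) -lt0n bin_gt0.
by rewrite divfK.
Qed.
End Leibniz.

(** * Coefficients of the generating polynomial and their recursion *)

HB.instance Definition _ (K : fieldType) (A : finType) :=
  GRing.Linear.copy (@dbar K A) (mder (@xpred K A)).

(** The test on [b i] is essential: [divcm] truncates, so [divcm b (ucm i)] would be [b] itself when
    [b i = 0]. *)
Lemma mcoeff_xvarM (K : fieldType) (I : choiceType) (i : I) (p : {malg K[{cmonom I}]})
    (b : {cmonom I}) :
  (xvar K i * p)@_b = if (0 < b i)%N then p@_(divcm b (ucm i)) else 0.
Proof.
rewrite malgM_def fgmulUg raddf_sum /=.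
under eq_bigr => m _ do rewrite mul1r mcoeffU.
case: ifPn => bi; last first.
  rewrite big1 // => m _; case: eqP => // E; case/negP: bi.
  by rewrite -E cmM cmUU.
have E m : (mmul (ucm i) m == b) = (m == divcm b (ucm i)).
  apply/eqP/eqP => [<-|->]; apply/eqP/cmP => j; rewrite ?(divcmE, cmM, cmU).
    by rewrite addnC addnK.
  by rewrite subnKC //; case: eqP => // <-.
under eq_bigr => m _ do rewrite E.
case: (msuppP p (divcm b (ucm i))) => h.
  rewrite (big_fsetD1 (divcm b (ucm i))) //= eqxx mulr1n big1_fset ?addr0 //.
  by move=> m; rewrite in_fsetD1 => /andP[/negPf ->].
rewrite big_seq big1 // => m; case: eqP => [->|] //; by rewrite (negPf h).
Qed.

Definition zle (j : zidx) : {fset zidx} :=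
  fset_set [set s : zidx | val s <= val j].

Lemma in_zle (j s : zidx) : (s \in zle j) = (val s <= val j).
Proof.
rewrite in_fset_set; last exact: finite_zidx_le.
by apply/idP/idP; rewrite inE.
Qed.

Section Generating.
Variables (K : fieldType) (A : finType).
Hypothesis charK : [pchar K] =i pred0.
Implicit Types (k b : multiindex A).

Lemma Cgen_coefE k b r :
  (Cgen_coef K k b)`_r = r`!%:R^-1 * (iter r (@dbar K A) (xmon K k))@_b.
Proof.
rewrite coef_map /= -mcoeffZ; congr (mcoeff b _).
(* Nilpotency cuts the sum over all r down to r < N; for r >= N both sides vanish. *)
have [N HN] := dbar_nilpotent (xmon K k).
have Z i : i \notin iota 0 N -> iter i (@dbar K A) (xmon K k) = 0.
  by rewrite mem_iota /= => Ni; apply: HN; rewrite leqNgt.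
rewrite /Cgen (fsbigE (iota 0 N)) ?iota_uniq //; last first.
  by move=> i _ /Z ->; rewrite scaler0 scale0r.
under eq_bigl => i do rewrite in_setT.
have -> : iota 0 N = index_iota 0 N by rewrite /index_iota subn0.
rewrite big_mkord -(poly_def N (fun i => i`!%:R^-1 *: iter i (@dbar K A) (xmon K k))).
rewrite coef_poly; case: ltnP => // Nr.
by rewrite HN // scaler0.
Qed.

(** Each application lowers the index by one, so at most the term s = j - r survives, and none once
    j - r < -1. The form as a sum over s is what allows the exchange with the Leibniz sum. *)
Lemma iter_dbar_xvar a (j : zidx) r :
  iter r (@dbar K A) (xvar K ((a, j) : varidx A)) =
  \sum_(s <- zle j) xvar K ((a, s) : varidx A) *+ (r == zgap j s).
Proof.
(* Extending the variables by zero to every integer index below -1 gives the single formula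
   [x (val j - r)], valid also after the variable has died. *)
pose x (z : int) : NA K A :=
  if insub z is Some s then xvar K ((a, s) : varidx A) else 0.
have -> : iter r (@dbar K A) (xvar K ((a, j) : varidx A)) = x (val j - r%:Z).
  elim: r => [|r IH]; first by rewrite subr0 /x /= valK.
  rewrite iterS IH {1}/x; case: insubP => [s _ Es|h].
    have -> : val j - r.+1%:Z = val s - 1 by rewrite Es; lia.
    by rewrite /dbar mder_xvar.
  by rewrite linear0 /x insubF //; apply: contraNF h => /=; lia.
rewrite /x; case: insubP => [s h Es|h].
  have sj : s \in zle j by rewrite in_zle Es /=; lia.
  rewrite (big_fsetD1 s) //= big1_fset ?addr0.
    by have -> : r == zgap j s by rewrite /zgap Es /=; lia.
  move=> t; rewrite in_fsetD1 in_zle => /andP[ts tj] _.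
  have /negPf -> // : r != zgap j t.
  by apply: contra ts => /eqP rE; apply/eqP/val_inj; rewrite Es rE /zgap /=; move: tj => /=; lia.
rewrite big_seq big1 // => s; rewrite in_zle => sj.
have /negPf -> // : r != zgap j s.
by have := valP s; rewrite /zgap; move: h sj => /=; lia.
Qed.

Lemma Cgen_coefM a (j : zidx) k b :
  Cgen_coef K (mmul (ucm ((a, j) : varidx A)) k) b =
  \sum_(s <- zle j) ((zgap j s)`!%:R^-1 *: 'X^(zgap j s)) *
    (if (0 < b (a, s))%N
     then Cgen_coef K k (divcm b (ucm ((a, s) : varidx A))) else 0).
Proof.
apply/polyP => r; rewrite Cgen_coefE -mcoeffZ coef_sum.
have -> : xmon K (mmul (ucm ((a, j) : varidx A)) k) =
    xvar K ((a, j) : varidx A) * xmon K k.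
  by rewrite !xmonE /xvar monM.
rewrite (@iter_derivM_div _ _ _ (@dbarM K A)) // raddf_sum /=.
under eq_bigr => i _ do
  rewrite iter_dbar_xvar scaler_sumr mulr_suml raddf_sum /=.
rewrite exchange_big /=; apply: eq_bigr => s _.
set Q := (X in _ * X).
(* For fixed s only the Leibniz term i = [zgap j s] contributes; if it exceeds r, the power of 'X on
   the right has no coefficient at r either. *)
pose G (i : nat) : K := i`!%:R^-1 * Q`_(r - i).
have E (i : nat) : ((i`!%:R^-1 *: (xvar K ((a, s) : varidx A) *+ (i == zgap j s))) *
    ((r - i)`!%:R^-1 *: iter (r - i) (@dbar K A) (xmon K k)))@_b =
  if i == zgap j s then G i else 0.
  case: eqP => _; last by rewrite mulr0n scaler0 mul0r mcoeff0.
  rewrite -scalerAl -scalerAr mulr1n !mcoeffZ mcoeff_xvarM /G /Q.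
  by case: ifP; rewrite ?Cgen_coefE // coef0 !mulr0.
under eq_bigr => i _ do rewrite E.
rewrite -big_mkcond (big_ord1_eq _ G) ltnS -scalerAl coefZ coefXnM ltnNge.
by case: leqP => //= _; rewrite mulr0.
Qed.

Lemma Cgen_coef1 b : Cgen_coef K (mone : multiindex A) b = (mone == b)%:R.
Proof.
apply/polyP => r; rewrite Cgen_coefE xmonE -polyC_natr coefC.
case: r => [|r].
  rewrite fact0 invr1 mul1r [iter _ _ _]/= mcoeffU1 [0%N == _]eqxx.
  congr (_ *+ _).
rewrite iterSr [X in iter _ _ X]mderU /mder_mon mdom1 big_seq_fset0.
have -> : iter r (@dbar K A) 0 = 0 by elim: r => //= r ->; rewrite linear0.
by rewrite mcoeff0 mulr0.
Qed.
End Generating.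

(** * Transport arrays on finitely many rows, and adding one unit to an entry *)

Section Transport.
Variables (K : fieldType) (A : finType).
Hypothesis charK : [pchar K] =i pred0.
Implicit Types (k b : multiindex A) (n : A -> zidx -> zidx -> nat).
Implicit Types (J : {fset zidx}) (a : A) (j s : zidx).

Local Notation ix a j := ((a, j) : varidx A).

(* Finite products over rows j in J replace the products over all j >= -1 as
   soon as k is carried by J. *)
Definition carried J k := forall a j, k (ix a j) != 0%N -> j \in J.

(** This is the divided power $t^m/m!$ of $t = u^{j-s}/(j-s)!$, the whole contribution of an entry m
    at (j, s). *)
Definition transport_mon j s (m : nat) : {poly K} :=
  (m`!%:R^-1 / (zgap j s)`!%:R ^+ m) *: 'X^(zgap j s * m).

Definition transport_prod J n : {poly K} :=
  \prod_(a : A) \prod_(j <- J) \prod_(s <- zle j) transport_mon j s (n a j s).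

(** For J carrying k this is the multi-index factorial of k, the part of each summand that does not
    depend on the array. *)
Definition mfact J k : K :=
  \prod_(a : A) \prod_(j <- J) (k (ix a j))`!%:R.

Lemma prod_scaleX (T : Type) (r : seq T) (c : T -> K) (m : T -> nat) :
  \prod_(i <- r) (c i *: 'X^(m i)) =
  (\prod_(i <- r) c i) *: 'X^(\sum_(i <- r) m i)%N.
Proof.
elim: r => [|i r IH]; first by rewrite !big_nil expr0 scale1r.
by rewrite !big_cons IH -scalerAl -scalerAr scalerA exprD.
Qed.

(** Rows outside J have k = 0, hence n = 0, and contribute neutral factors; on J the three products
    are merged entry by entry. *)
Lemma transport_termE J k b n : carried J k -> transport k b n ->
  (transport_coef K k n / transport_denom K n) *: 'X^(transport_weight n) =
  mfact J k *: transport_prod J n.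
Proof.
move=> kJ nt; have le := transport_le nt.
have n0 a j s : j \notin J -> n a j s = 0%N.
  move=> jJ; apply/eqP; rewrite -leqn0; apply: leq_trans (le a j s) _.
  by rewrite leqn0; apply: contraNT jJ => /kJ.
have k0 a j : j \notin J -> k (ix a j) = 0%N.
  by move=> jJ; apply/eqP; apply: contraNT jJ => /kJ.
have zleE (R : Type) (idx : R) (op : Monoid.com_law idx) j (F : zidx -> R) :
    \big[op/idx]_(s \in [set s : zidx | val s <= val j]) F s =
    \big[op/idx]_(s <- zle j) F s.
  by rewrite fsbig_finite //; exact: finite_zidx_le.
have -> : transport_coef K k n = mfact J k *
    \prod_(a : A) \prod_(j <- J) \prod_(s <- zle j) (n a j s)`!%:R^-1.
  rewrite /mfact -big_split; apply: eq_bigr => a _ /=.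
  rewrite -big_split (fsbigTE J) => [|j jJ].
    by apply: eq_bigr => j _; rewrite zleE prodfV.
  rewrite k0 // fact0 zleE big1 ?divr1 // => s _; by rewrite n0.
have -> : transport_denom K n =
    \prod_(a : A) \prod_(j <- J) \prod_(s <- zle j) (zgap j s)`!%:R ^+ n a j s.
  apply: eq_bigr => a _; rewrite (fsbigTE J) => [|j jJ].
    by apply: eq_bigr => j _; rewrite zleE.
  by rewrite zleE big1 // => s _; rewrite n0.
have -> : transport_weight n =
    (\sum_(a : A) \sum_(j <- J) \sum_(s <- zle j) zgap j s * n a j s)%N.
  apply: eq_bigr => a _; rewrite (fsbigTE J) => [|j jJ].
    by apply: eq_bigr => j _; rewrite zleE.
  by rewrite zleE big1 // => s _; rewrite n0 ?muln0.
rewrite -mulrA -scalerA; congr (_ *: _).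
rewrite -prodfV -big_split /= -prod_scaleX; apply: eq_bigr => a _ /=.
rewrite -prodfV -big_split /= -prod_scaleX; apply: eq_bigr => j _ /=.
by rewrite -prodfV -big_split /= -prod_scaleX.
Qed.

Definition incr a0 j0 s0 n : A -> zidx -> zidx -> nat :=
  fun a j s => (n a j s + [&& a == a0, j == j0 & s == s0])%N.

(** The divided-power identity $(m+1) \cdot t^{m+1}/(m+1)! = t \cdot t^m/m!$. *)
Lemma transport_mon_incr j s m :
  m.+1%:R *: transport_mon j s m.+1 =
  ((zgap j s)`!%:R^-1 *: 'X^(zgap j s)) * transport_mon j s m.
Proof.
rewrite /transport_mon -scalerAl -scalerAr !scalerA -exprD -mulnS.
congr (_ *: _); rewrite factS natrM exprS !invfM !mulrA mulfV ?mul1r.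
  by congr (_ / _); rewrite mulrC.
by rewrite ((pcharf0P K).1 charK).
Qed.

Lemma transport_prod_incr J a0 j0 s0 n : j0 \in J -> val s0 <= val j0 ->
  (n a0 j0 s0).+1%:R *: transport_prod J (incr a0 j0 s0 n) =
  ((zgap j0 s0)`!%:R^-1 *: 'X^(zgap j0 s0)) * transport_prod J n.
Proof.
rewrite -in_zle => jJ sj.
rewrite /transport_prod (bigD1 a0) //= (big_fsetD1 j0) //= (big_fsetD1 s0) //=.
rewrite [in RHS](bigD1 a0) //= [in RHS](big_fsetD1 j0) //= [in RHS](big_fsetD1 s0) //=.
rewrite !scalerAl !mulrA {1}/incr !eqxx addn1 transport_mon_incr.
congr (_ * _ * _ * _).
- rewrite !big_seq; apply: eq_bigr => s; rewrite in_fsetD1 => /andP[/negPf ss _].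
  by rewrite /incr ss !andbF addn0.
- rewrite !big_seq; apply: eq_bigr => j; rewrite in_fsetD1 => /andP[/negPf jj _].
  by apply: eq_bigr => s _; rewrite /incr jj andbF addn0.
- apply: eq_bigr => a /negPf aa; apply: eq_bigr => j _; apply: eq_bigr => s _.
  by rewrite /incr aa addn0.
Qed.

(** A column sum over j >= s may be taken over J: entries with j < s vanish by triangularity, and
    entries with j outside J because their row sum is zero. *)
Lemma transportP J k b n : carried J k -> transport k b n <->
  [/\ forall a j s, val j < val s -> n a j s = 0%N,
      forall a j, (\sum_(s <- zle j) n a j s)%N = k (ix a j)
    & forall a s, (\sum_(j <- J) n a j s)%N = b (ix a s)].
Proof.
move=> kJ.
have zleE a j :
    \big[addn/0%N]_(s \in [set s : zidx | val s <= val j]) n a j s =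
    (\sum_(s <- zle j) n a j s)%N.
  by rewrite fsbig_finite //; exact: finite_zidx_le.
suff JE : (forall a j s, val j < val s -> n a j s = 0%N) ->
    (forall a j, (\sum_(s <- zle j) n a j s)%N = k (ix a j)) -> forall a s,
    \big[addn/0%N]_(j \in [set j : zidx | val s <= val j]) n a j s =
    (\sum_(j <- J) n a j s)%N.
  split=> [[n0 nk nb]|[n0 nk nb]].
    have nk' a j : (\sum_(s <- zle j) n a j s)%N = k (ix a j).
      by rewrite -zleE nk.
    by split=> // a s; rewrite -JE // nb.
  by split=> // [a j|a s]; rewrite ?zleE ?JE.
move=> n0 nk a s.
rewrite (@fsbig_widen _ _ _ addn _ setT) // => [|j [_ /= /negP]]; last first.
  by rewrite -ltNge => /n0.
apply: fsbigTE => j jJ; have [js|sj] := ltP (val j) (val s); first exact: n0.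
have k0 : k (ix a j) = 0%N by apply/eqP; apply: contraNT jJ => /kJ.
by move/eqP: (nk a j); rewrite k0 (big_fsetD1 s) ?in_zle //= addn_eq0 => /andP[/eqP].
Qed.

(** The increment adds one to exactly one row sum and one column sum, and s0 <= j0 keeps the array
    triangular. *)
Lemma transport_incr J a0 j0 s0 k b n : val s0 <= val j0 -> j0 \in J ->
  carried J k ->
  transport (mmul (ucm (ix a0 j0)) k) (mmul (ucm (ix a0 s0)) b)
    (incr a0 j0 s0 n) <-> transport k b n.
Proof.
move=> sj jJ kJ; have kJ' : carried J (mmul (ucm (ix a0 j0)) k).
  by move=> a j; rewrite cmM cmU; case: (ix a0 j0 =P ix a j) => [[_ <-]|_ /kJ].
rewrite (transportP _ _ _ _ kJ) (transportP _ _ _ _ kJ').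
have rowE a j : (\sum_(s <- zle j) incr a0 j0 s0 n a j s)%N =
    (ucm (ix a0 j0) (ix a j) + \sum_(s <- zle j) n a j s)%N.
  rewrite big_split addnC; congr (_ + _)%N; rewrite cmU xpair_eqE.
  have [_|_] := eqVneq a a0; last exact: big1.
  have [jE|_] := eqVneq j j0; last exact: big1.
  rewrite (big_fsetD1 s0) ?in_zle ?jE //= eqxx big1_fset // => s.
  by rewrite in_fsetD1 => /andP[/negPf ->].
have colE a s : (\sum_(j <- J) incr a0 j0 s0 n a j s)%N =
    (ucm (ix a0 s0) (ix a s) + \sum_(j <- J) n a j s)%N.
  rewrite big_split addnC; congr (_ + _)%N; rewrite cmU xpair_eqE.
  have [_|_] := eqVneq a a0; last exact: big1.
  have [_|_] := eqVneq s s0; last by apply: big1 => j _; rewrite andbF.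
  rewrite (big_fsetD1 j0) //= eqxx big1_fset // => j.
  by rewrite in_fsetD1 => /andP[/negPf ->].
split=> -[n0 nk nb]; split=> [a j s js|a j|a s].
- by have /eqP := n0 a j s js; rewrite addn_eq0 => /andP[/eqP].
- by have /eqP := nk a j; rewrite rowE cmM eqn_add2l => /eqP.
- by have /eqP := nb a s; rewrite colE cmM eqn_add2l => /eqP.
- rewrite /incr n0 //; case: and3P => // -[_ /eqP jj /eqP ss].
  by move: js; rewrite jj ss ltNge sj.
- by rewrite rowE cmM nk.
- by rewrite colE cmM nb.
Qed.
End Transport.

(** * The recursion for the sum over arrays, and the induction *)

Section Recursion.
Variables (K : fieldType) (A : finType).
Hypothesis charK : [pchar K] =i pred0.
Implicit Types (k b : multiindex A) (n : A -> zidx -> zidx -> nat).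
Implicit Types (J : {fset zidx}) (a : A) (j s : zidx).

Local Notation ix a j := ((a, j) : varidx A).

Definition transport_sum J k b : {poly K} :=
  \sum_(n \in transport k b) transport_prod K A J n.

Lemma mul_divcm (I : choiceType) (i : I) (b : {cmonom I}) :
  (0 < b i)%N -> mmul (ucm i) (divcm b (ucm i)) = b.
Proof.
move=> bi; apply/eqP/cmP => j; rewrite cmM divcmE cmU.
by case: eqP => [<-|_] /=; rewrite ?subnKC ?add0n ?subn0.
Qed.

(* A transport array with a marked entry (a, j, s) is an array from k - e_(a,j)
   to b - e_(a,s) with that entry incremented. *)
Lemma transport_sum_marked J a j s k b :
    carried A J (mmul (ucm (ix a j)) k) -> s \in zle j ->
  \sum_(n \in transport (mmul (ucm (ix a j)) k) b)
      (n a j s)%:R *: transport_prod K A J n =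
  ((zgap j s)`!%:R^-1 *: 'X^(zgap j s)) *
    (if (0 < b (ix a s))%N
     then transport_sum J k (divcm b (ucm (ix a s))) else 0).
Proof.
move=> kJ; rewrite in_zle => sj.
have jJ : j \in J by apply: (kJ a); rewrite cmM cmUU.
have kJ' : carried A J k.
  by move=> a' j' h; apply: (kJ a'); rewrite cmM addn_eq0 negb_and h orbT.
case: ifPn => [bs|b0]; last first.
  (* A zero column sum forces the marked entry to be 0, so every weight vanishes. *)
  rewrite mulr0 fsbig1 // => n /(transportP _ _ _ _ _ kJ) [_ _ nb].
  have := nb a s; rewrite (big_fsetD1 j) //=.
  by move: b0; rewrite -eqn0Ngt => /eqP -> /eqP; rewrite addn_eq0 => /andP[/eqP -> _];
    rewrite scale0r.
rewrite -{1}(mul_divcm _ _ _ bs); set b' := divcm _ _; rewrite /transport_sum mulr_fsumr.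
(* Arrays with entry 0 have weight 0; on the remaining ones, [T], a unit can be removed, so [incr]
   is a bijection onto [T]. *)
pose T := [set n | transport (mmul (ucm (ix a j)) k) (mmul (ucm (ix a s)) b') n /\
  (0 < n a j s)%N].
rewrite -(@fsbig_widen _ _ _ _ T) => [|n []//|n [nt /= /not_andP[//|/negP]]]; last first.
  by rewrite -eqn0Ngt => /eqP ->; rewrite scale0r.
rewrite (reindex_fsbig (incr A a j s) (transport k b')); last first.
  split=> [n nt|n n' _ _ E|n [nt np]].
  - split; first exact/(transport_incr _ J).
    by rewrite /incr !eqxx addn1.
  - apply/funext => a'; apply/funext => j'; apply/funext => s'.
    by have /(congr1 (fun f => f a' j' s')) /eqP := E; rewrite eqn_add2r => /eqP.
  - pose n' a' j' s' := (n a' j' s' - [&& a' == a, j' == j & s' == s])%N.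
    have nE : incr A a j s n' = n.
      apply/funext => a'; apply/funext => j'; apply/funext => s'.
      rewrite /incr /n' subnK //; case: and3P => // -[/eqP -> /eqP -> /eqP ->].
      exact: np.
    by exists n' => //; apply/(transport_incr _ J a j s); rewrite ?nE.
apply: eq_fsbigr => n _; rewrite -(transport_prod_incr _ _ charK J a) //.
by rewrite {1}/incr !eqxx addn1.
Qed.

Lemma transport_sumM J a j k b : carried A J (mmul (ucm (ix a j)) k) ->
  (k (ix a j)).+1%:R *: transport_sum J (mmul (ucm (ix a j)) k) b =
  \sum_(s <- zle j) ((zgap j s)`!%:R^-1 *: 'X^(zgap j s)) *
    (if (0 < b (ix a s))%N
     then transport_sum J k (divcm b (ucm (ix a s))) else 0).
Proof.
move=> kJ; rewrite [RHS]big_seq.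
under [RHS]eq_bigr => s sj do rewrite -(transport_sum_marked J a j s k b kJ sj).
rewrite -[RHS]big_seq /transport_sum fsbig_finite; last exact: transport_finite.
under [RHS]eq_bigr => s _ do rewrite (fsbig_finite _ _ (@transport_finite _ _ _)).
(* After the exchange, the weights [n a j s] of each array add up over s to its row sum, which is
   the left-hand factor. *)
rewrite exchange_big scaler_sumr /= !big_seq; apply: eq_bigr => n.
rewrite in_fset_set; last exact: transport_finite.
rewrite inE => /(transportP _ _ _ _ _ kJ) [_ nk _].
by rewrite -scaler_suml -natr_sum nk cmM cmUU.
Qed.

(** The factor gained here is exactly the one that [transport_sumM] absorbs. *)
Lemma mfactM J a j k : j \in J ->
  mfact K A J (mmul (ucm (ix a j)) k) =
  (k (ix a j)).+1%:R * mfact K A J k.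
Proof.
move=> jJ; rewrite /mfact (bigD1 a) //= (big_fsetD1 j) //=.
rewrite [in RHS](bigD1 a) //= [in RHS](big_fsetD1 j) //= !mulrA.
rewrite cmM cmUU factS natrM; congr (_ * _ * _).
  rewrite !big_seq; apply: eq_bigr => j'; rewrite in_fsetD1 => /andP[jj _].
  by rewrite cmM cmU xpair_eqE eqxx eq_sym (negPf jj).
apply: eq_bigr => a' aa; apply: eq_bigr => j' _.
by rewrite cmM cmU xpair_eqE eq_sym (negPf aa).
Qed.

(** Zero row sums leave only the zero array, whose column sums are zero and whose product is 1. *)
Lemma transport_sum1 J b : transport_sum J mone b = (mone == b)%:R.
Proof.
have kJ : carried A J (mone : multiindex A) by move=> a j; rewrite cm1 eqxx.
have n0 b' n : transport (mone : multiindex A) b' n -> n = fun _ _ _ => 0%N.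
  move=> nt; apply/funext => a; apply/funext => j; apply/funext => s; apply/eqP.
  by rewrite -leqn0 -(cm1 (ix a j)); exact: (transport_le nt).
rewrite /transport_sum; case: eqP => [<-|nb].
  have -> : transport (mone : multiindex A) mone = [set fun _ _ _ => 0%N].
    apply/seteqP; split=> [n nt|n ->]; first exact: n0 nt.
    by apply/(transportP _ _ _ _ _ kJ); split=> // a j; rewrite cm1 big1.
  rewrite fsbig_set1 /transport_prod big1 // => a _.
  rewrite big1 // => j _; rewrite big1 // => s _.
  by rewrite /transport_mon muln0 !expr0 fact0 divr1 invr1 scale1r.
rewrite fsbig1 // => n nt; case: nb; apply/esym/eqP/cmP => -[a s]; rewrite cm1.
have /(transportP _ _ _ _ _ kJ) [_ _ nb] := nt.
by rewrite -nb (n0 _ _ nt) big1.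
Qed.

Lemma Cgen_coef_transport_sum J k b : carried A J k ->
  Cgen_coef K k b = mfact K A J k *: transport_sum J k b.
Proof.
(* Induction on the degree of k with b generalized, since the recursion lowers both; J stays
   fixed. *)
have [d] := ubnP (mdeg k); elim: d k b => // d IH k b kd kJ.
have [->|k1] := eqVneq k mone.
  rewrite Cgen_coef1 transport_sum1 /mfact big1 ?scale1r // => a _.
  by rewrite big1 // => j _; rewrite cm1.
have [[a j] ki] : exists i, (0 < k i)%N.
  have [//|h] := pselect (exists i, (0 < k i)%N).
  case/eqP: k1; apply/eqP/cmP => i; rewrite cm1; apply/eqP; rewrite eqn0Ngt.
  by apply/negP => ki; apply: h; exists i.
rewrite -(mul_divcm _ _ _ ki) in kd kJ *; move: {k1 ki}(divcm k _) kd kJ => k' kd kJ.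
have jJ : j \in J by apply: (kJ a); rewrite cmM cmUU.
rewrite (Cgen_coefM _ _ charK) mfactM // [_%:R * _]mulrC -scalerA transport_sumM // scaler_sumr.
apply: eq_bigr => s _; rewrite scalerAr; congr (_ * _).
case: ifP => _; last by rewrite scaler0.
apply: IH; first by move: kd; rewrite mdegM mdegU.
by move=> a' j' h; apply: (kJ a'); rewrite cmM addn_eq0 negb_and h orbT.
Qed.
End Recursion.

Theorem theorem5p10 (K : fieldType) (charK : [pchar K] =i pred0)
    (A : finType) (k b : multiindex A) :
  Cgen_coef K k b =
    \sum_(n \in transport k b)
      (transport_coef K k n / transport_denom K n) *: 'X^(transport_weight n)
  /\ (transport k b = set0 -> Cgen_coef K k b = 0).
Proof.
suff E : Cgen_coef K k b =
    \sum_(n \in transport k b)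
      (transport_coef K k n / transport_denom K n) *: 'X^(transport_weight n).
  by split=> // k0; rewrite E k0 fsbig_set0.
(* The rows that occur in the support of k, for any a, form a finite set carrying k. *)
pose J := [fset i.2 | i in finsupp k]%fset.
have kJ : carried A J k.
  by move=> a j; rewrite cmE_neq0 => kaj; apply/imfsetP; exists (a, j).
rewrite (Cgen_coef_transport_sum _ _ charK J) // /transport_sum.
rewrite !fsbig_finite; try exact: transport_finite.
rewrite scaler_sumr big_seq [RHS]big_seq; apply: eq_bigr => n.
rewrite in_fset_set; last exact: transport_finite.
by rewrite inE => nt; rewrite (transport_termE _ _ J _ b).
Qed.
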